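(* For $k=1,\dots,K$, let $\mathbf y^{k*}_{M,a}$ and $\mathbf y^{k*}_{M,b}$ be the $\mathbf y^k$-components of the (unique) optimal solutions of the linear program $\mathrm{LP}^k_M$ under inputs $(\mathbf y^{k+1}_a,\dots,\mathbf y^K_a,\mathbf x_a)$ and $(\mathbf y^{k+1}_b,\dots,\mathbf y^K_b,\mathbf x_b)$ respectively. Then $$\|\mathbf y^{k*}_{M,a}-\mathbf y^{k*}_{M,b}\|_\infty\le\kappa\Big(\|\mathbf y^{k+1}_a-\mathbf y^{k+1}_b\|_\infty+\dots+\|\mathbf y^K_a-\mathbf y^K_b\|_\infty+\|\mathbf x_a-\mathbf x_b\|_\infty\Big),$$ where the constant $\kappa$ depends only on $(m,n_1,\dots,n_K)$ and $A^k$ ($1\le k\le K$) (in particular not on $M$).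
   Context: There are $m$ products and $n$ components. $A$ is an $n\times m$ non-negative integer matrix with at least one non-zero entry in every row and every column. The components are partitioned into $K$ consecutive groups of sizes $n_1,\dots,n_K$ with $\sum_kn_k=n$; $A^k$ is the $n_k\times m$ submatrix of $A$ formed by the rows of group $k$. $\mathbf h\in\mathbb R^n$, $\mathbf b\in\mathbb R^m$ have strictly positive entries, $\mathbf h^k$ is the part of $\mathbf h$ for group $k$, $\mathbf c=\mathbf b+\sum_k(A^k)'\mathbf h^k$. $\mathbf D^1,\dots,\mathbf D^K$ are independent random vectors in $\mathbb Z_+^m$ ($\mathbf D^k$ is a compound Poisson demand over an interval of length $L_k-L_{k-1}$, $0=L_0<L_1<\dots<L_K$). For an integer $M>0$, $\mathbf D^k_M=\mathbf D^k\wedge\mathbf M$ (componentwise minimum; $\mathbf M$ the vector with all entries $M$), which has finite support. **Scenario strings.** For $0\le k'<k\le K$, $\Omega_k^{k'}$ is the set of strings $\bar\omega=\omega^k\cdots\omega^{k'+1}$ encoding realizations of $(\mathbf D^k_M,\dots,\mathbf D^{k'+1}_M)$, with probability $\mathbb P(\bar\omega)=\prod_{l=k'+1}^k\Pr\{\mathbf D^l_M=\mathbf D^l_M(\omega^l)\}$. $\bar\omega'\sqsubset\bar\omega$ means $\bar\omega'$ is a prefix of $\bar\omega$. For $\bar\omega\in\Omega_k^0$, $\underline{\mathbf D}^k_M(\bar\omega)=\mathbf D^k_M(\omega^k)+\dots+\mathbf D^1_M(\omega^1)$. **$\mathrm{LP}^k_M$ with inputs $(\mathbf y^{k+1},\dots,\mathbf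 y^K,\mathbf x)$.** The variables are $\mathbf y^k\in\mathbb R^{n_k}$, $\mathbf y^{k'}(\bar\omega')\in\mathbb R^{n_{k'}}$ ($1\le k'<k$, $\bar\omega'\in\Omega_k^{k'}$), $\mathbf z(\bar\omega)\in\mathbb R^m$ ($\bar\omega\in\Omega_k^0$). Minimize $$\mathbf h^k\cdot\mathbf y^k+\sum_{k'=1}^{k-1}\sum_{\bar\omega\in\Omega_k^{k'}}\mathbb P(\bar\omega)\mathbf h^{k'}\cdot\mathbf y^{k'}(\bar\omega)-\sum_{\bar\omega\in\Omega_k^0}\mathbb P(\bar\omega)\mathbf c\cdot\mathbf z(\bar\omega)$$ subject to - $\mathbf z(\bar\omega)\le\mathbf x+\underline{\mathbf D}^k_M(\bar\omega)$, $\bar\omega\in\Omega_k^0$; - $A^{k'}\mathbf z(\bar\omega)-\mathbf y^{k'}(\bar\omega')\le\mathbf 0$, $\bar\omega\in\Omega_k^0$, $\bar\omega'\in\Omega_k^{k'}$, $\bar\omega'\sqsubset\bar\omega$, $1\le k'<k$; - $A^k\mathbf z(\bar\omega)-\mathbf y^k\le\mathbf 0$, $\bar\omega\in\Omega_k^0$; - $A^{k'}\mathbf z(\bar\omega)\le\mathbf y^{k'}$, $\bar\omega\in\Omega_k^0$, $k<k'\le K$. The objective coefficients ($\mathbb P(\bar\omega)$, $\mathbf h^{k'}$, $\mathbf c$) are understood to be slightly perturbed, with the same perturbed values used for all inputs, so that the optimal solutions considered are unique. *)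

(* Defs.v *)
From HB Require Import structures.
From mathcomp Require Export all_boot all_order all_algebra.
From mathcomp Require Export all_classical all_reals all_analysis.
Import Order.TTheory GRing.Theory Num.Theory.
Import numFieldNormedType.Exports.

Set Implicit Arguments.
Unset Strict Implicit.
Unset Printing Implicit Defensive.

Local Open Scope classical_set_scope.
Local Open Scope ring_scope.

Definition le_cv (R : realType) n (u v : 'cV[R]_n) : Prop :=
  forall i, u i 0 <= v i 0.

Definition pos_cv (R : realType) n (u : 'cV[R]_n) : Prop :=
  forall i, 0 < u i 0.

Definition dot (R : realType) n (u v : 'cV[R]_n) : R :=
  \sum_i u i 0 * v i 0.

Definition nat_mx (R : realType) m n (A : 'M[nat]_(m, n)) : 'M[R]_(m, n) :=
  map_mx (fun a => a%:R) A.

(* The coefficient vector c = b + sum_k (A^k)' h^k.  The n rows of A are split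
   into K consecutive blocks of sizes n_ 0, ..., n_ (K-1), and submxcol extracts
   a block.  The group numbered k >= 1 in mathematical notation is the ordinal
   k - 1 of 'I_K, here and below. *)
Definition cost_c (R : realType) K m (n_ : 'I_K -> nat)
    (A : 'M[nat]_(\sum_(k < K) n_ k, m)) (h : 'cV[R]_(\sum_(k < K) n_ k))
    (b : 'cV[R]_m) : 'cV[R]_m :=
  b + \sum_(k < K) (nat_mx R (submxcol A k))^T *m submxcol h k.

Section Demand.
Context (R : realType) (K m : nat).
Context (d : measure_display) (T : measurableType d) (P : probability T R).

(* Random vectors in Z_+^m; the countable set Z_+^m carries the discrete
   sigma-algebra. *)
Definition random_vector (X : T -> 'cV[nat]_m) : Prop :=
  forall B : set 'cV[nat]_m, measurable (X @^-1` B).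

Definition independent (D : 'I_K -> T -> 'cV[nat]_m) : Prop :=
  forall B : 'I_K -> set 'cV[nat]_m,
    P (\bigcap_(k in [set: 'I_K]) (D k @^-1` B k)) =
    (\prod_(k < K) P (D k @^-1` B k))%E.

Definition batch_law (mu : 'cV[nat]_m -> R) : Prop :=
  (forall v, 0 <= mu v) /\ (\esum_(v in [set: 'cV[nat]_m]) (mu v)%:E = 1)%E.

(* Pr{S_1 + ... + S_j = v} for S_1, ..., S_j i.i.d. with law mu *)
Definition batch_sum_law (mu : 'cV[nat]_m -> R) (j : nat) (v : 'cV[nat]_m)
    : \bar R :=
  (\esum_(s in [set s : {ffun 'I_j -> 'cV[nat]_m} | (\sum_(i < j) s i)%R = v])
     ((\prod_(i < j) mu (s i))%R)%:E)%E.

(* X has the law of S_1 + ... + S_N, with N Poisson of parameter rate and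
   independent of the i.i.d. batches S_i of law mu. *)
Definition compound_poisson (rate : R) (mu : 'cV[nat]_m -> R)
    (X : T -> 'cV[nat]_m) : Prop :=
  forall v, P (X @^-1` [set v]) =
    (\sum_(0 <= j <oo) (poisson_pmf rate j)%:E * batch_sum_law mu j v)%E.

Definition trunc (M : nat) (v : 'cV[nat]_m) : 'cV[nat]_m := map_mx (minn M) v.

(* Law of D^k /\ M, on the finite type {0..M}^m of its possible values *)
Definition trunc_law (D : 'I_K -> T -> 'cV[nat]_m) (M : nat) (k : 'I_K)
    (a : 'cV['I_M.+1]_m) : R :=
  fine (P [set t | trunc M (D k t) = map_mx (@nat_of_ord M.+1) a]).

End Demand.

Section LinearProgram.
Context (R : realType) (K m : nat) (n_ : 'I_K -> nat).
Context (A : 'M[nat]_(\sum_(k < K) n_ k, m)).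
Context (M : nat) (law : 'I_K -> 'cV['I_M.+1]_m -> R) (k : 'I_K).

(* Position i of a string omega^k omega^(k-1) ... belongs to group k - i. *)
Definition level (i : nat) : 'I_K :=
  Ordinal (leq_ltn_trans (leq_subr i k) (ltn_ord k)).

(* The strings omega^k ... omega^(k'+1), highest group first; each letter is a
   value of the truncated demand of its group having positive probability.  As k
   is the ordinal of the group numbered k.+1, while k' is a group number (or 0),
   the length is k.+1 - k'. *)
Definition Omega (k' : nat) : predArgType :=
  {w : (k.+1 - k').-tuple 'cV['I_M.+1]_m |
    [forall i : 'I_(k.+1 - k'), 0 < law (level i) (tnth w i)]}.

Definition letters k' (w : Omega k') : seq 'cV['I_M.+1]_m := tval (val w).

Definition scenario_prob k' (w : Omega k') : R :=
  \prod_(i < k.+1 - k') law (level i) (tnth (val w) i).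

Definition total_demand (w : Omega 0) : 'cV[R]_m :=
  nat_mx R (\sum_(i < k.+1 - 0)
    map_mx (@nat_of_ord M.+1) (tnth (val w) i)).

Definition below (j : 'I_k) : 'I_K := widen_ord (ltnW (ltn_ord k)) j.

(* The ordinal j < k is the group numbered j.+1, so that its variables are
   indexed by Omega j.+1. *)
Record lp_vars := LpVars {
  var_y : 'cV[R]_(n_ k);
  var_ysub : forall j : 'I_k, Omega j.+1 -> 'cV[R]_(n_ (below j));
  var_z : Omega 0 -> 'cV[R]_m }.

Record lp_costs := LpCosts {
  cost_prob : forall k', Omega k' -> R;
  cost_hold : 'cV[R]_(\sum_(k < K) n_ k);
  cost_z : 'cV[R]_m }.

Definition nominal_costs (h : 'cV[R]_(\sum_(k < K) n_ k)) (b : 'cV[R]_m)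
    : lp_costs :=
  LpCosts scenario_prob h (cost_c A h b).

Definition costs_within (eps : R) (q q' : lp_costs) : Prop :=
  [/\ forall k' (w : Omega k'), (k' <= k)%N ->
        `|cost_prob q w - cost_prob q' w| <= eps,
      forall i, `|cost_hold q i 0 - cost_hold q' i 0| <= eps
    & forall i, `|cost_z q i 0 - cost_z q' i 0| <= eps].

Definition lp_objective (q : lp_costs) (u : lp_vars) : R :=
  dot (submxcol (cost_hold q) k) (var_y u)
  + \sum_(j < k) \sum_(w : Omega j.+1)
      cost_prob q w * dot (submxcol (cost_hold q) (below j)) (var_ysub u w)
  - \sum_(w : Omega 0) cost_prob q w * dot (cost_z q) (var_z u w).

(* Of the family y, only the members of index greater than k are inputs. *)
Definition lp_feasible (y : forall j : 'I_K, 'cV[R]_(n_ j)) (x : 'cV[R]_m)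
    (u : lp_vars) : Prop :=
  [/\ forall w : Omega 0, le_cv (var_z u w) (x + total_demand w),
      forall (j : 'I_k) (w : Omega 0) (w' : Omega j.+1),
        prefix (letters w') (letters w) ->
        le_cv (nat_mx R (submxcol A (below j)) *m var_z u w - var_ysub u w') 0,
      forall w : Omega 0,
        le_cv (nat_mx R (submxcol A k) *m var_z u w - var_y u) 0
    & forall (w : Omega 0) (j : 'I_K), (k < j)%N ->
        le_cv (nat_mx R (submxcol A j) *m var_z u w) (y j)].

Definition lp_optimal (q : lp_costs) (y : forall j : 'I_K, 'cV[R]_(n_ j))
    (x : 'cV[R]_m) (u : lp_vars) : Prop :=
  lp_feasible y x u /\
  forall v, lp_feasible y x v -> lp_objective q u <= lp_objective q v.

Definition lp_unique_optimal (q : lp_costs)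
    (y : forall j : 'I_K, 'cV[R]_(n_ j)) (x : 'cV[R]_m) (u : lp_vars) : Prop :=
  lp_optimal q y x u /\ forall v, lp_optimal q y x v -> v = u.

End LinearProgram.

(* Main.v *)
From HB Require Import structures.
Require Import Defs.
From mathcomp Require Import ring lra.
Import Order.TTheory GRing.Theory Num.Theory.
Import numFieldNormedType.Exports.

(** Two ideas carry the proof: optimal solutions can be made to move slowly with
    the inputs, and the speed that this requires depends on a scenario tree only
    through finitely many patterns.

    Moving the optimum.  Let the inputs travel on the segment from [a] to [b],
    with time [t] in [0, 1].  A feasible point is optimal as soon as the objective
    does not decrease along any direction that respects its tight constraints
    ([dual_feasible_optimal]), a property of the tight set alone.  At an optimum
    [u] at time [t < 1], the best velocity solves a linear program of its own, and
    an optimal velocity can be chosen so extremal that every solution of the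
    equations tight at it is an equally good velocity ([advance]).  If all these
    systems of equations, whenever solvable, have solutions of y^k-speed at most
    [speed], the optimum can be continued at this speed.  The last time reached is
    the value of a linear program, hence attained, hence equal to 1
    ([optimum_follows]).  The optimum found at time 1 is the given one, because
    that one is unique.

    Bounding the speed. What remains is to bound, uniformly in the tree, the
    y^k-part of a suitable solution of a system made of equations [z(w) = x]
    and [A z(w) = y(w)], each holding for some pairs of a scenario [w] and a
    row; here [z], [y] and [x] are velocities, so that demands have
    disappeared. Two leaves with the same set of tight rows impose the same
    linear conditions on their ancestors. By induction on the height, the
    conditions that a subtree imposes on the variables above it depend only on
    its [pattern], which ranges over iterated power sets of the set of rows.
    So the pairs (y^k, inputs) that extend to a solution on the whole tree
    form one of finitely many subspaces ([tight_system_related],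
    [lift_to_scenarios]). In each of them y^k can be chosen as a fixed linear
    function of the inputs, and [kappa] is obtained by summing the norms of
    these linear functions ([tree_bound]). *)

Set Implicit Arguments.
Unset Strict Implicit.
Unset Printing Implicit Defensive.
Local Open Scope ring_scope.

(** * Linear programs with finitely many constraints *)

Definition linear_form (R : realType) (V : lmodType R) (f : V -> R) : Prop :=
  forall a u v, f (a *: u + v) = a * f u + f v.

Section LinearForm.
Context (R : realType) (V : lmodType R) (f : V -> R) (fL : linear_form f).

Lemma linear_formD u v : f (u + v) = f u + f v.
Proof. by rewrite -[u in LHS]scale1r fL mul1r. Qed.

Lemma linear_form0 : f 0 = 0.
Proof. by apply: (addrI (f 0)); rewrite -linear_formD !addr0. Qed.

Lemma linear_formZ a u : f (a *: u) = a * f u.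
Proof. by rewrite -[a *: u]addr0 fL linear_form0 addr0. Qed.

Lemma linear_formN u : f (- u) = - f u.
Proof. by rewrite -scaleN1r linear_formZ mulN1r. Qed.

Lemma linear_formB u v : f (u - v) = f u - f v.
Proof. by rewrite linear_formD linear_formN. Qed.

End LinearForm.

Lemma finite_union_max (R : realType) (I : finType) (X : Type)
    (P : I -> X -> Prop) (g : X -> R) :
  (forall i, (exists x, P i x) ->
     exists2 x, P i x & forall y, P i y -> g y <= g x) ->
  (exists i x, P i x) ->
  exists i x, P i x /\ forall j y, P j y -> g y <= g x.
Proof.
move=> maxP [i0 [x0 Px0]].
have [x1 Px1 _] := maxP i0 (ex_intro _ x0 Px0).
have best i : exists x, (exists x, P i x) ->
    P i x /\ forall y, P i y -> g y <= g x.
  have [/maxP[x Px xmax]|noP] := pselect (exists x, P i x).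
    by exists x.
  by exists x0 => /noP.
have [b bP] := fin_all_exists best.
pose ne i := `[< exists x, P i x >].
have ne0 : ne i0 by apply/asboolP; exists x0.
case: (@Order.TotalTheory.arg_maxP _ R I i0 ne (fun i => g (b i)) ne0) =>
  i nei imax.
have [Pi _] := bP i (asboolW nei).
exists i, (b i); split=> // j y Pjy.
have nej : exists x, P j x by exists y.
apply: le_trans (imax j (asboolT nej)).
by have [_ ->] := bP j nej.
Qed.

(** Finitely many slack constraints stay satisfied along a short enough step.
    The step is a harmonic sum rather than a minimum over the constraints whose
    slope is positive, so that no case distinction on the slopes is needed. *)
Lemma small_step (R : realType) (C : finType) (D : {set C}) (gap s : C -> R)
    (t0 : R) :
  0 < t0 -> (forall c, c \in D -> 0 < gap c) ->
  exists2 t, 0 < t <= t0 & forall c, c \in D -> t * s c <= gap c.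
Proof.
move=> t0_gt0 gap_gt0.
pose S := \sum_(c in D) `|s c| / gap c.
have S_ge0 : 0 <= S.
  by apply: sumr_ge0 => c cD; rewrite divr_ge0 // ltW // gap_gt0.
have tS_gt0 : 0 < t0^-1 + S by rewrite ltr_wpDr // invr_gt0.
exists (t0^-1 + S)^-1.
  by rewrite invr_gt0 tS_gt0 /= -[leRHS]invrK lef_pV2 ?posrE ?invr_gt0 // lerDl.
move=> c cD; rewrite mulrC ler_pdivrMr // mulrC -ler_pdivrMr ?gap_gt0 //.
apply: (@le_trans _ _ (`|s c| / gap c)).
  by rewrite ler_pM2r ?invr_gt0 ?gap_gt0 // ler_norm.
apply: (@le_trans _ _ S); last by rewrite lerDr invr_ge0 ltW.
rewrite /S (bigD1 c) //= lerDl; apply: sumr_ge0 => i /andP[iD _].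
by rewrite divr_ge0 // ltW // gap_gt0.
Qed.

Section Polyhedron.
Context (R : realType) (V : lmodType R) (C : finType).
Context (D : {set C}) (B : C -> V -> R) (BL : forall c, linear_form (B c)).
Context (r : C -> R).

Definition in_polyhedron (u : V) : Prop := forall c, c \in D -> B c u <= r c.

Definition tight (u : V) : {set C} := [set c in D | B c u == r c].

(** The substitute for vertices: the ambient space may be infinite-dimensional,
    or the polyhedron may contain lines, but one can still ask that the tight
    constraints determine the value of every constraint. *)
Definition extremal (u : V) : Prop :=
  forall e, (forall c, c \in tight u -> B c e = 0) ->
  forall c, c \in D -> B c e = 0.

(** The ratio test of the simplex method: the first constraint to become tight
    along [e] is the one that minimizes slack over slope. *)
Lemma tighten (u e : V) (c0 : C) :
  in_polyhedron u -> (forall c, c \in tight u -> B c e = 0) ->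
  c0 \in D -> 0 < B c0 e ->
  exists2 t, 0 <= t &
    in_polyhedron (u + t *: e) /\ (tight u \proper tight (u + t *: e)).
Proof.
move=> uP ker_e c0D c0e.
pose rising c := (c \in D) && (0 < B c e).
pose slope c := (r c - B c u) / B c e.
have rising0 : rising c0 by rewrite /rising c0D.
case: (@Order.TotalTheory.arg_minP _ R C c0 rising slope rising0) =>
  c1 /andP[c1D c1e] c1min.
have BtE c t : B c (u + t *: e) = B c u + t * B c e.
  by rewrite (linear_formD (BL c)) (linear_formZ (BL c)).
have t_ge0 : 0 <= slope c1 by rewrite divr_ge0 ?subr_ge0 ?uP // ltW.
have tight1 : B c1 (u + slope c1 *: e) = r c1.
  by rewrite BtE divfK ?gt_eqF //; ring.
exists (slope c1) => //; split.
  move=> c cD; rewrite BtE; have [ce|ce] := ltrP 0 (B c e); last first.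
    have := uP c cD; have := mulr_ge0_le0 t_ge0 ce; lra.
  have : slope c1 <= slope c by apply: c1min; rewrite /rising cD.
  by rewrite {2}/slope ler_pdivlMr //; lra.
apply/properP; split.
  apply/fintype.subsetP => c ct; move: (ct); rewrite !inE BtE ker_e //.
  by rewrite mulr0 addr0.
exists c1; first by rewrite inE c1D tight1 eqxx.
by apply/negP => /ker_e c1e0; rewrite c1e0 ltxx in c1e.
Qed.

Section Maximum.
Context (g : V -> R) (gL : linear_form g).
Context (recession : forall e, (forall c, c \in D -> B c e <= 0) -> g e <= 0).

(** A direction that leaves the tight constraints unchanged but not all
    constraints can be followed, up to sign, without decreasing the objective;
    the recession hypothesis forces it to hit a new constraint.  The number of
    constraints that are not tight therefore decreases until the point is
    extremal. *)
Lemma improve_to_extremal (u : V) : in_polyhedron u ->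
  exists v, [/\ in_polyhedron v, extremal v & g u <= g v].
Proof.
have [n] := ubnP #|~: tight u|; elim: n u => // n IHn u ltun uP.
have [ext|notext] := pselect (extremal u); first by exists u.
have [e [c0 [ker_e c0D c0e]]] : exists e c,
    [/\ forall c, c \in tight u -> B c e = 0, c \in D & B c e != 0].
  apply: contra_notP notext => noline e ker_e c cD; apply/eqP.
  by apply: contrapT => /negP ce; apply: noline; exists e, c.
(* A direction of positive objective must raise a constraint by the recession
   hypothesis; one of zero objective can be reversed so that it does. *)
wlog [ge c0_gt0] : e c0 ker_e c0D c0e / 0 <= g e /\ exists2 c, c \in D & 0 < B c e.
  move=> wlog_e.
  have ker_Ne c : c \in tight u -> B c (- e) = 0.
    by move=> /ker_e ce; rewrite (linear_formN (BL c)) ce oppr0.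
  have c0Ne : B c0 (- e) != 0 by rewrite (linear_formN (BL c0)) oppr_eq0.
  have rises e' : 0 < g e' -> exists2 c, c \in D & 0 < B c e'.
    move=> ge'; apply: contrapT => norise.
    suff : g e' <= 0 by rewrite leNgt ge'.
    apply: recession => c cD; rewrite leNgt; apply/negP => ce'.
    by apply: norise; exists c.
  case: (ltgtP (g e) 0) => ge.
  - have gNe : 0 < g (- e) by rewrite (linear_formN gL) oppr_gt0.
    by apply: (wlog_e (- e) c0) => //; split; [exact: ltW | exact: rises].
  - by apply: (wlog_e e c0) => //; split; [exact: ltW | exact: rises].
  - case: (ltgtP (B c0 e) 0) c0e => // c0e _.
    + apply: (wlog_e (- e) c0) => //; rewrite (linear_formN gL) ge oppr0.
      by split=> //; exists c0; rewrite // (linear_formN (BL c0)) oppr_gt0.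
    + apply: (wlog_e e c0) => //; first by rewrite gt_eqF.
      by rewrite ge; split=> //; exists c0.
case: c0_gt0 => c1 c1D c1e.
have [t t_ge0 [utP lt_tight]] := tighten uP ker_e c1D c1e.
have [|v [vP vext gv]] := IHn (u + t *: e) _ utP.
  rewrite ltnS in ltun; apply: leq_trans ltun; apply: proper_card.
  by rewrite properE !finset.setCS -properE.
exists v; split=> //; apply: le_trans gv.
by rewrite (linear_formD gL) (linear_formZ gL) lerDl mulr_ge0.
Qed.

(** Two extremal points with the same tight set differ by a direction on which
    all constraints, hence also the objective, vanish.  So extremal points take
    finitely many values, and every point is dominated by an extremal one. *)
Lemma lp_attained : (exists u, in_polyhedron u) ->
  exists u, [/\ in_polyhedron u, extremal u &
               forall v, in_polyhedron v -> g v <= g u].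
Proof.
move=> [u0 u0P].
pose P (I : {set C}) v := [/\ in_polyhedron v, extremal v & tight v = I].
have constP I v w : P I v -> P I w -> g v <= g w.
  move=> [vP vext vI] [wP wext wI].
  have ker_d c : c \in D -> B c (v - w) = 0.
    apply: vext => {}c; rewrite (linear_formB (BL c)) => cv.
    move: (cv); rewrite vI -wI; move: cv; rewrite !inE.
    by move=> /andP[_ /eqP->] /andP[_ /eqP->]; rewrite subrr.
  rewrite -subr_le0 -(linear_formB gL); apply: recession => c /ker_d ->.
  by [].
have [I [u [[uP uext _] umax]]] : exists I u,
    P I u /\ forall J v, P J v -> g v <= g u.
  apply: finite_union_max; first by move=> I [v vP]; exists v => // w /constP; apply.
  by have [v [vP vext _]] := improve_to_extremal u0P; exists (tight v), v.
exists u; split=> // v /improve_to_extremal[w [wP wext gvw]].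
by apply: le_trans gvw _; apply: umax; split.
Qed.

End Maximum.

(** By Farkas' lemma this says that [q] is a combination with non-positive
    coefficients of the constraints in [I], that is, that some dual solution is
    supported on [I].  The form below needs no multipliers, and it is visibly
    preserved when [I] grows. *)
Definition dual_feasible (q : V -> R) (I : {set C}) : Prop :=
  forall e, (forall c, c \in I -> B c e <= 0) -> 0 <= q e.

Lemma dual_feasible_optimal (q : V -> R) (qL : linear_form q) (u v : V) :
  dual_feasible q (tight u) -> in_polyhedron v -> q u <= q v.
Proof.
move=> dual vP; rewrite -subr_ge0 -(linear_formB qL); apply: dual => c.
rewrite (linear_formB (BL c)) inE => /andP[cD /eqP->].
by rewrite subr_le0 vP.
Qed.

Lemma optimal_dual_feasible (q : V -> R) (qL : linear_form q) (u : V) :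
  in_polyhedron u -> (forall v, in_polyhedron v -> q u <= q v) ->
  dual_feasible q (tight u).
Proof.
move=> uP umin e tight_e.
pose loose := D :\: tight u.
have [t /andP[t_gt0 _] tP] : exists2 t : R, 0 < t <= 1 &
    forall c, c \in loose -> t * B c e <= r c - B c u.
  apply: small_step => // c; rewrite !inE => /andP[].
  by rewrite subr_gt0 lt_neqAle => + cD; rewrite cD uP // andbT.
have : q u <= q (u + t *: e).
  apply: umin => c cD; rewrite (linear_formD (BL c)) (linear_formZ (BL c)).
  have [cl|ct] := boolP (c \in loose); first by have := tP c cl; lra.
  have {}ct : c \in tight u by apply: contraNT ct => nct; rewrite inE nct cD.
  have := tight_e c ct; rewrite -(pmulr_rle0 _ t_gt0); have := uP c cD; lra.
by rewrite (linear_formD qL) (linear_formZ qL) lerDl pmulr_rge0.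
Qed.

End Polyhedron.

(** * Continuing an optimal solution along moving constraints *)

Section Sensitivity.
Context (R : realType) (V : lmodType R) (C J : finType).
Context (B : C -> V -> R) (BL : forall c, linear_form (B c)).
Context (q : V -> R) (qL : linear_form q).
Context (eta : J -> V -> R) (etaL : forall j, linear_form (eta j)).
Context (r d : C -> R) (speed : R).

Definition feasible_at (t : R) : V -> Prop :=
  in_polyhedron [set: C] B (fun c => r c + t * d c).

Definition tight_at (t : R) : V -> {set C} :=
  tight [set: C] B (fun c => r c + t * d c).

(** The pairs (solution, time) that can be attained from [u0] within the speed
    limit.  Asking for the constraints of a fixed set [I] to be tight makes this
    a polyhedron in the product of the solution space and the time axis. *)
Definition reached (u0 : V) (I : {set C}) (w : V * R) : Prop :=
  [/\ w.2 <= 1, feasible_at w.2 w.1, I \subset tight_at w.2 w.1 &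
      forall j, `|eta j (w.1 - u0)| <= w.2 * speed].

(** Maximizing the time is itself a linear program.  Solving it replaces a
    compactness argument, which is not available in this generality. *)
Lemma reached_attained (u0 : V) (I : {set C}) :
  (exists w, reached u0 I w) ->
  exists2 w, reached u0 I w & forall w', reached u0 I w' -> w'.2 <= w.2.
Proof.
pose C' : finType := (unit + (C + C) + (J + J))%type.
pose B' (c : C') (w : V * R^o) : R := match c with
  | inl (inl _) => w.2
  | inl (inr (inl c)) => B c w.1 - w.2 * d c
  | inl (inr (inr c)) => w.2 * d c - B c w.1
  | inr (inl j) => eta j w.1 - w.2 * speed
  | inr (inr j) => - eta j w.1 - w.2 * speed
  end.
pose r' (c : C') : R := match c with
  | inl (inl _) => 1
  | inl (inr (inl c)) => r c
  | inl (inr (inr c)) => - r c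
  | inr (inl j) => eta j u0
  | inr (inr j) => - eta j u0
  end.
pose D' : {set C'} :=
  [set c | if c is inl (inr (inr c)) then c \in I else true].
have B'L c : linear_form (B' c).
  move=> a u v; case: c => [[_|[c|c]]|[j|j]] /=;
    rewrite ?BL ?etaL; rewrite /GRing.scale /=; ring.
have reachedE w : reached u0 I w <-> in_polyhedron D' B' r' w.
  split=> [[w1 wF /fintype.subsetP wI weta]|wP].
    move=> c; case: c => [[[]|[c|c]]|[j|j]]; rewrite inE //= => cD.
    - have := wF c (finset.in_setT c); lra.
    - by have := wI c cD; rewrite !inE /= => /eqP->; lra.
    - by have := weta j; rewrite (linear_formB (etaL j)) ler_norml; lra.
    - by have := weta j; rewrite (linear_formB (etaL j)) ler_norml; lra.
  split.
  - by apply: (wP (inl (inl tt))); rewrite inE.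
  - move=> c _; have := wP (inl (inr (inl c))); rewrite inE /= => /(_ isT); lra.
  - apply/fintype.subsetP => c cI; rewrite !inE /= eq_le.
    have := wP (inl (inr (inl c))); rewrite inE /= => /(_ isT).
    have := wP (inl (inr (inr c))); rewrite inE /= => /(_ cI).
    by move=> ? ?; apply/andP; split; lra.
  - move=> j; rewrite (linear_formB (etaL j)) ler_norml.
    have := wP (inr (inl j)); rewrite inE /= => /(_ isT).
    have := wP (inr (inr j)); rewrite inE /= => /(_ isT).
    by move=> ? ?; apply/andP; split; lra.
move=> [w0 /reachedE w0P].
have [|||w [/reachedE wP _ wmax]] :=
    @lp_attained R (V * R^o)%type C' D' B' B'L r' (fun w => w.2) _ _ _.
- by [].
- by move=> e /(_ (inl (inl tt))); rewrite inE; apply.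
- by exists w0.
by exists w => // w' /reachedE; apply: wmax.
Qed.

Hypothesis solvable_with_speed : forall (I : {set C}) (e : V),
  (forall c, c \in I -> B c e = d c) ->
  exists2 e', forall c, c \in I -> B c e' = d c &
              forall j, `|eta j e'| <= speed.

(** From an optimum at time [t], look for the optimal velocity: minimize [q]
    over the velocities that do not violate the constraints tight at [u].  This
    program is feasible, because the segment towards [u1] provides a velocity,
    and bounded, because [I] is dual feasible.  At an extremal optimal velocity
    [e] the tight set [I'] is dual feasible, and every other solution [e'] of the
    equations of [I'] gives the same value to all constraints of the program.
    So [e'] may be chosen slow, and [u + s *: e'] is again optimal for small
    [s], as its tight set contains [I']. *)
Lemma advance (u0 : V) (I : {set C}) (t : R) (u u1 : V) :
  reached u0 I (u, t) -> dual_feasible B q I -> t < 1 -> feasible_at 1 u1 ->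
  exists I' w', [/\ reached u0 I' w', dual_feasible B q I' & t < w'.2].
Proof.
move=> [/= t_le1 uF Itight ueta] Idual t_lt1 u1F.
pose T := tight_at t u.
have Tdual : dual_feasible B q T.
  move=> e eT; apply: Idual => c cI; apply: eT.
  by apply: (fintype.subsetP Itight).
have TE c : c \in T -> B c u = r c + t * d c.
  by rewrite !inE /= => /eqP.
have [|||e [eP eext emax]] := @lp_attained R V C T B BL d (fun v => - q v) _ _ _.
- by move=> a v w; rewrite qL; ring.
- by move=> v vT; rewrite oppr_le0; apply: Tdual.
- exists ((1 - t)^-1 *: (u1 - u)) => c cT.
  have t'_gt0 : 0 < 1 - t by rewrite subr_gt0.
  rewrite (linear_formZ (BL c)) (linear_formB (BL c)) mulrC ler_pdivrMr //.
  by have := u1F c (finset.in_setT c); rewrite (TE c cT); lra.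
pose I' := tight T B d e.
have I'dual : dual_feasible B q I'.
  apply: (optimal_dual_feasible BL qL eP) => v /emax; lra.
have [|e' e'I' e'speed] := @solvable_with_speed I' e.
  by move=> c; rewrite inE => /andP[_ /eqP].
have e'P c : c \in T -> B c e' <= d c.
  move=> cT; suff -> : B c e' = B c e by apply: eP.
  apply/eqP; rewrite -subr_eq0 -(linear_formB (BL c)); apply/eqP.
  apply: eext => // {cT}c cI'; rewrite (linear_formB (BL c)) e'I' //.
  by move: cI'; rewrite inE => /andP[_ /eqP->]; rewrite subrr.
have [s /andP[s_gt0 s_le] sP] : exists2 s : R, 0 < s <= 1 - t &
    forall c, c \in ~: T -> s * (B c e' - d c) <= r c + t * d c - B c u.
  apply: small_step; first by rewrite subr_gt0.
  move=> c; rewrite !inE /= subr_gt0 lt_neqAle => ->.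
  by rewrite uF ?finset.in_setT.
have BE c : B c (u + s *: e') = B c u + s * B c e'.
  by rewrite (linear_formD (BL c)) (linear_formZ (BL c)).
exists I', (u + s *: e', t + s); split=> //=; last by rewrite ltrDl.
split=> /=; first lra.
- move=> c _; rewrite BE; have [cT|cT] := boolP (c \in T).
    have := e'P c cT; rewrite -(ler_pM2l s_gt0) (TE c cT); lra.
  by have := sP c; rewrite finset.in_setC => /(_ cT); lra.
- apply/fintype.subsetP => c cI'; rewrite !inE /= BE e'I' //.
  have cT : c \in T by move: cI'; rewrite inE => /andP[].
  by rewrite (TE c cT); apply/eqP; ring.
- move=> j; rewrite -addrAC (linear_formD (etaL j)) (linear_formZ (etaL j)).
  apply: le_trans (ler_normD _ _) _; rewrite mulrDl lerD //.
  by rewrite normrM gtr0_norm // ler_pM2l.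
Qed.

(** An optimum at time 1 close to the given optimum at time 0: the set of times
    that can be reached has a maximum by [reached_attained], and this maximum is
    1 by [advance]. *)
Theorem optimum_follows (u0 u1 : V) :
  feasible_at 0 u0 -> (forall v, feasible_at 0 v -> q u0 <= q v) ->
  feasible_at 1 u1 ->
  exists u, [/\ feasible_at 1 u, forall v, feasible_at 1 v -> q u <= q v &
                forall j, `|eta j (u - u0)| <= speed].
Proof.
move=> u0F u0min u1F.
pose P I w := reached u0 I w /\ dual_feasible B q I.
have [I [[u t] [[uR Idual] tmax]]] : exists I w,
    P I w /\ forall I' w', P I' w' -> w'.2 <= w.2.
  apply: finite_union_max => [I [w0 [w0R Idual]]|].
    have [w wR wmax] := reached_attained (ex_intro _ w0 w0R).
    by exists w => // w' [/wmax].
  exists (tight_at 0 u0), (u0, 0); split.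
    by split=> //= j; rewrite subrr (linear_form0 (etaL j)) normr0 mul0r.
  exact: (optimal_dual_feasible BL qL u0F u0min).
have t1 : t = 1.
  have [/= t_le1 _ _ _] := uR; apply/eqP; rewrite eq_le t_le1 /= leNgt.
  apply/negP => t_lt1.
  have [I' [w' [w'R I'dual]]] := advance uR Idual t_lt1 u1F.
  by rewrite ltNge (tmax I').
case: uR; rewrite t1 /= => _ uF Itight ueta; exists u; split=> //.
  move=> v vF; apply: (dual_feasible_optimal BL qL _ vF) => e eT.
  by apply: Idual => c cI; apply: eT; apply: (fintype.subsetP Itight).
by move=> j; rewrite -[speed]mul1r.
Qed.

End Sensitivity.

(** * Systems of tight constraints on a scenario tree *)

Section Tree.
Context (R : realType) (m : nat) (Row : finType).
Context (H : Row -> 'I_m -> R) (lev : Row -> nat).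

(** Everything that a single scenario sees: its own decision [z], and the
    right-hand side of each row of the constraint matrix. *)
Definition coord : finType := ('I_m + Row)%type.

Definition at_coord (v : 'rV[R]_#|coord|) (c : coord) : R := v 0 (enum_rank c).

Definition of_coords (f : coord -> R) : 'rV[R]_#|coord| :=
  \row_i f (enum_val i).

Lemma of_coordsE f c : at_coord (of_coords f) c = f c.
Proof. by rewrite /at_coord mxE enum_rankK. Qed.

Definition row_eqn (r : Row) : 'cV[R]_#|coord| :=
  \sum_l H r l *: delta_mx (enum_rank (inl l : coord)) 0
  - delta_mx (enum_rank (inr r : coord)) 0.

Lemma row_eqnP (v : 'rV_#|coord|) (r : Row) :
  (v <= kermx (row_eqn r))%MS <->
  \sum_l H r l * at_coord v (inl l) = at_coord v (inr r).
Proof.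
have mul_delta c : v *m delta_mx (enum_rank c) 0 = (at_coord v c)%:M :> 'M[R]_1.
  by rewrite -colE; apply/matrixP=> i j; rewrite !mxE !ord1 mulr1n.
have eqnE : v *m row_eqn r =
    (\sum_l H r l * at_coord v (inl l) - at_coord v (inr r))%:M.
  rewrite mulmxBr mulmx_sumr mul_delta raddfB raddf_sum /=; congr (_ - _).
  apply: eq_bigr => l _.
  by rewrite -scalemxAr mul_delta scale_scalar_mx.
split=> [/sub_kermxP|eqn].
  rewrite eqnE => /matrixP/(_ 0 0); rewrite !mxE mulr1n.
  by move/eqP; rewrite subr_eq0 => /eqP.
by apply/sub_kermxP; rewrite eqnE eqn subrr raddf0.
Qed.

Definition is_below (e : nat) (c : coord) : bool :=
  if c is inr r then (lev r < e)%N else true.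

(** What a parent does not share with its child of height [e]: the decision [z]
    and the variables of the child and of its descendants. *)
Definition below_space (e : nat) : 'M[R]_#|coord| :=
  diag_mx (\row_i (is_below e (enum_val i))%:R).

Lemma below_spaceP (e : nat) (v : 'rV_#|coord|) :
  (v <= below_space e)%MS <->
  (forall c, ~~ is_below e c -> at_coord v c = 0).
Proof.
split=> [/submxP[u ->] c /negbTE nc|v0].
  by rewrite /at_coord mul_mx_diag mxE mxE enum_rankK nc mulr0.
apply/submxP; exists v; rewrite mul_mx_diag; apply/rowP => i; rewrite !mxE.
case: (boolP (is_below e (enum_val i))) => [_|/v0]; first by rewrite mulr1.
by rewrite /at_coord enum_valK => ->; rewrite mul0r.
Qed.

(** The shape of the tight constraints in a subtree of height [e].  A leaf is
    described by its set of tight rows, and an inner node by the set of the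
    descriptions of its children: children with equal descriptions impose equal
    conditions, so their number does not matter.  This is what makes the final
    constant independent of the number of scenarios. *)
Fixpoint pattern (e : nat) : finType :=
  if e is e'.+1 then {set pattern e'} else {set Row}.

(** The row space of [relation p] is the linear relation that a subtree of
    pattern [p] imposes on the coordinates of its root: adding [below_space]
    quantifies existentially over the variables that are chosen further down,
    and the intersection expresses that all the children share the variables of
    their ancestors. *)
Fixpoint relation (e : nat) : pattern e -> 'M[R]_#|coord| :=
  match e with
  | 0 => fun p : {set Row} => (\bigcap_(r in p) kermx (row_eqn r))%MS
  | e'.+1 => fun p : {set pattern e'} =>
      (\bigcap_(p' in p) (relation p' + below_space e'))%MS
  end.

(** The coordinates of level at least [e] determine a linear choice of an element of
    [U], through a pseudo-inverse of the projection restricted to [U]; a matrix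
    is a bounded map. *)
Lemma bounded_representative (U : 'M[R]_#|coord|) (e : nat) :
  exists2 kappa : R, 0 <= kappa &
  forall (v : 'rV_#|coord|) (rho : R), (v <= U)%MS -> 0 <= rho ->
    (forall c, ~~ is_below e c -> `|at_coord v c| <= rho) ->
  exists v', [/\ (v' <= U)%MS,
    forall c, ~~ is_below e c -> at_coord v' c = at_coord v c &
    forall c, `|at_coord v' c| <= kappa * rho].
Proof.
pose above : 'M[R]_#|coord| :=
  diag_mx (\row_i (~~ is_below e (enum_val i))%:R).
have aboveE (v : 'rV_#|coord|) c :
    at_coord (v *m above) c = if is_below e c then 0 else at_coord v c.
  rewrite /at_coord mul_mx_diag !mxE enum_rankK.
  by case: is_below; rewrite ?mulr0 ?mulr1.
pose G := pinvmx (U *m above) *m U.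
exists (\sum_i \sum_j `|G i j|).
  by apply: sumr_ge0 => i _; apply: sumr_ge0.
move=> v rho vU rho_ge0 v_le.
exists (v *m above *m G); split=> [|c /negbTE nc|c].
- by rewrite /G !mulmxA submxMl.
- have: v *m above *m G *m above = v *m above.
    by rewrite /G mulmxA -mulmxA mulmxKpV // submxMr.
  by move/(congr1 (at_coord^~ c)); rewrite !aboveE nc.
- rewrite /at_coord mxE mulr_suml; apply: le_trans (ler_norm_sum _ _ _) _.
  apply: ler_sum => i _; rewrite normrM mulrC.
  apply: ler_pM => //.
    by rewrite (bigD1 (enum_rank c)) //= lerDl sumr_ge0.
  rewrite -[i]enum_valK -/(at_coord _ _) aboveE.
  by case: ifPn => [_|/v_le //]; rewrite normr0.
Qed.

(** A decomposition along a sum [U + F] that is a function of the vector, so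
    that scenarios sharing a history make the same choice. *)
Definition lower m1 (U F : 'M[R]_#|coord|) (t : 'M[R]_(m1, #|coord|)) :=
  lsubmx (t *m pinvmx (col_mx U F)) *m U.

Lemma lowerP m1 (U F : 'M[R]_#|coord|) (t : 'M[R]_(m1, #|coord|)) :
  (t <= U + F)%MS ->
  (lower U F t <= U)%MS /\ (t - lower U F t <= F)%MS.
Proof.
rewrite addsmxE => tUF; split; first exact: submxMl.
rewrite -{1}(mulmxKpV tUF) -[_ *m pinvmx _]hsubmxK mul_row_col addrC addKr.
exact: submxMl.
Qed.

(** A scenario tree is given by its leaves and, for each height [e], a key that
    identifies the ancestor of height [e]: two leaves have the same ancestor when
    their keys agree. *)
Section Scenarios.
Context (Leaf : finType) (Key : eqType) (key : nat -> Leaf -> Key).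
Hypothesis key0_inj : injective (key 0).
Hypothesis key_coarser : forall e w w',
  key e w = key e w' -> key e.+1 w = key e.+1 w'.

Lemma key_coarserW e f w w' :
  (e <= f)%N -> key e w = key e w' -> key f w = key f w'.
Proof.
move=> /subnK <-; elim: (f - e)%N => // n IHn /IHn; exact: key_coarser.
Qed.

(** Non-anticipativity: the variables of level [e] belong to the node of height
    [e.+1]. *)
Definition adapted (zeta : Leaf -> Row -> R) : Prop :=
  forall r w w', key (lev r).+1 w = key (lev r).+1 w' -> zeta w r = zeta w' r.

Context (I : {set Leaf * Row}).

Fixpoint tight_pattern (e : nat) (w : Leaf) : pattern e :=
  match e with
  | 0 => [set r | (w, r) \in I] : {set Row}
  | e'.+1 =>
      [set tight_pattern e' w' | w' in [pred w' | key e'.+1 w' == key e'.+1 w]]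
  end.

Lemma tight_pattern_adapted e w w' :
  key e w = key e w' -> tight_pattern e w = tight_pattern e w'.
Proof.
by case: e => [/key0_inj -> //|e kww'] /=; rewrite kww'.
Qed.

(** Necessity of the relation, from the leaves upwards: two leaves below the
    same node agree on all levels that are not projected away. *)
Lemma tight_system_related (v : Leaf -> 'rV[R]_#|coord|) :
  (forall w r, (w, r) \in I -> (v w <= kermx (row_eqn r))%MS) ->
  adapted (fun w r => at_coord (v w) (inr r)) ->
  forall e w, (v w <= relation (tight_pattern e w))%MS.
Proof.
move=> vI v_adapted; elim=> [|e IHe] w /=.
  by apply/sub_bigcapmxP => r; rewrite inE; apply: vI.
apply/sub_bigcapmxP => p /imsetP[w' /eqP kww' ->].
rewrite -[v w](subrK (v w')) addrC; apply: addmx_sub_adds; first exact: IHe.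
apply/below_spaceP => -[//|r]; rewrite /= -leqNgt => le_er.
rewrite /at_coord !mxE; apply/eqP; rewrite subr_eq0; apply/eqP.
by apply: v_adapted; apply: key_coarserW (esym kww').
Qed.

(** Sufficiency of the relation, from the root downwards: a vector related to a
    node is corrected, on the coordinates that are chosen below that node only,
    into a vector related to each of its children.  The conclusion about levels
    starts at [e.-1] since the first correction made at a node of height [e]
    leaves its own level untouched. *)
Lemma lift_to_scenarios (e : nat) (t : Leaf -> 'rV[R]_#|coord|) :
  (forall w w', key e w = key e w' -> t w = t w') ->
  (forall w, (t w <= relation (tight_pattern e w))%MS) ->
  exists v : Leaf -> 'rV[R]_#|coord|,
  [/\ forall w r, (w, r) \in I -> (v w <= kermx (row_eqn r))%MS,
      forall w r, (e <= (lev r).+1)%N ->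
        at_coord (v w) (inr r) = at_coord (t w) (inr r) &
      forall r w w', (lev r < e)%N -> key (lev r).+1 w = key (lev r).+1 w' ->
        at_coord (v w) (inr r) = at_coord (v w') (inr r)].
Proof.
elim: e t => [|e IHe] t t_adapted tP.
  exists t; split=> // w r wr; have /sub_bigcapmxP := tP w; apply.
  by rewrite inE.
pose t' w := lower (relation (tight_pattern e w)) (below_space e) (t w).
have t'P w : (t' w <= relation (tight_pattern e w))%MS /\
             (t w - t' w <= below_space e)%MS.
  apply: lowerP; have /sub_bigcapmxP := tP w; apply.
  by apply/imsetP; exists w; rewrite ?inE.
have t'E w r : (e <= lev r)%N ->
    at_coord (t' w) (inr r) = at_coord (t w) (inr r).
  move=> le_er; have [_ /below_spaceP/(_ (inr r))] := t'P w.
  rewrite /= -leqNgt /at_coord !mxE => /(_ le_er)/eqP.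
  by rewrite subr_eq0 => /eqP ->.
have [||v [vI vt' v_adapted]] := IHe t'.
- move=> w w' kww'; rewrite /t' (tight_pattern_adapted kww').
  by rewrite (t_adapted w w') //; apply: key_coarser.
- by move=> w; case: (t'P w).
exists v; split=> // [w r|r w w'].
  by rewrite ltnS => le_er; rewrite vt' ?t'E // ltnW.
rewrite ltnS leq_eqVlt => /predU1P[er|]; last exact: v_adapted.
rewrite er => kww'; rewrite !vt' ?er // !t'E ?er //.
by rewrite (t_adapted w w').
Qed.

End Scenarios.

(** The speed limit needed in [optimum_follows], for velocities [zeta] whose
    components above level [k] are those of the inputs.  The tree is quantified
    inside the definition, so that one [kappa] serves trees of all sizes. *)
Definition tree_bounded (k : nat) (kappa : R) : Prop :=
  forall (Leaf : finType) (Key : eqType) (key : nat -> Leaf -> Key),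
    injective (key 0) ->
    (forall e w w', key e w = key e w' -> key e.+1 w = key e.+1 w') ->
    (forall w w', key k.+1 w = key k.+1 w') ->
  forall (I : {set Leaf * Row}) (z : Leaf -> 'I_m -> R)
    (zeta : Leaf -> Row -> R) (rho : R),
    adapted key zeta ->
    (forall w r, (w, r) \in I -> \sum_l H r l * z w l = zeta w r) ->
    0 <= rho -> (forall w r, (k < lev r)%N -> `|zeta w r| <= rho) ->
  exists z' zeta',
  [/\ adapted key zeta',
      forall w r, (w, r) \in I -> \sum_l H r l * z' w l = zeta' w r,
      forall w r, (k < lev r)%N -> zeta' w r = zeta w r &
      forall w r, lev r = k -> `|zeta' w r| <= kappa * rho].

(** The solution at the root lies in [relation p] for one of the finitely many
    patterns [p]; move it to the bounded representative with the same data, and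
    lift the result back to the whole tree. *)
Theorem tree_bound (k : nat) :
  exists2 kappa : R, 0 <= kappa & tree_bounded k kappa.
Proof.
have [kap kap_ge0 kapP] := fin_all_exists2
  (fun p : pattern k.+1 => bounded_representative (relation p) k.+1).
exists (\sum_p kap p); first exact: sumr_ge0.
move=> Leaf Key key key0_inj key_coarser key_root I z zeta rho.
move=> zeta_adapted zI rho_ge0 zeta_le.
have [w0|noscen] := pickP (fun _ : Leaf => true); last first.
  by exists z, zeta; split=> // w; have := noscen w.
pose v w := of_coords (fun c => match c with inl l => z w l | inr r => zeta w r end).
have vI w r : (w, r) \in I -> (v w <= kermx (row_eqn r))%MS.
  move=> /zI eqn; apply/row_eqnP; rewrite of_coordsE -eqn.
  by apply: eq_bigr => l _; rewrite of_coordsE.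
have v_adapted : adapted key (fun w r => at_coord (v w) (inr r)).
  by move=> r w w' kww'; rewrite !of_coordsE; apply: zeta_adapted.
set p := tight_pattern key I k.+1 w0.
have [|//||v0 [v0p v0E v0_le]] := kapP p (v w0) rho.
- exact: tight_system_related.
- move=> [//|r]; rewrite /= -leqNgt => k_lt; rewrite of_coordsE.
  exact: zeta_le.
have pE w : tight_pattern key I k.+1 w = p.
  by apply: tight_pattern_adapted => //; apply: key_root.
have [||v' [v'I v'E v'_adapted]] :=
    @lift_to_scenarios _ _ key key0_inj key_coarser I k.+1 (fun=> v0).
- by [].
- by move=> w; rewrite pE.
have topE w r : (k < lev r)%N -> at_coord (v' w) (inr r) = zeta w r.
  move=> k_lt; rewrite v'E; last exact: leqW.
  rewrite v0E /= -?leqNgt // of_coordsE; apply: zeta_adapted.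
  apply: (key_coarserW key_coarser (ltnW _) (key_root w0 w)); exact: k_lt.
exists (fun w l => at_coord (v' w) (inl l)), (fun w r => at_coord (v' w) (inr r)).
split=> [r w w' kww'|w r /v'I/row_eqnP //|//|w r lev_r].
  have [k_lt|le_k] := ltnP k (lev r); last exact: v'_adapted.
  by rewrite !topE //; apply: zeta_adapted.
rewrite v'E ?lev_r //; apply: le_trans (v0_le _) _.
by apply: ler_wpM2r => //; rewrite (bigD1 p) //= lerDl sumr_ge0.
Qed.

End Tree.

(** * The vector space of variables *)

Section VariableSpace.
Context (R : realType) (K m : nat) (n_ : 'I_K -> nat) (M : nat).
Context (law : 'I_K -> 'cV['I_M.+1]_m -> R) (k : 'I_K).

Local Notation vars := (lp_vars n_ law k).

Lemma lp_vars_ext (u v : vars) :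
  var_y u = var_y v -> (forall j w, @var_ysub _ _ _ _ _ _ _ u j w = var_ysub v w) ->
  (forall w, var_z u w = var_z v w) -> u = v.
Proof.
case: u v => [uy us uz] [vy vs vz] /= -> eqs eqz; congr LpVars.
  by apply: functional_extensionality_dep => j; apply/funext => w; apply: eqs.
by apply/funext.
Qed.

Definition lp_zero : vars := LpVars 0 (fun _ _ => 0) (fun=> 0).
Definition lp_opp (u : vars) : vars :=
  LpVars (- var_y u) (fun j w => - var_ysub u w) (fun w => - var_z u w).
Definition lp_add (u v : vars) : vars :=
  LpVars (var_y u + var_y v) (fun j w => var_ysub u w + var_ysub v w)
         (fun w => var_z u w + var_z v w).
Definition lp_scale (a : R) (u : vars) : vars :=
  LpVars (a *: var_y u) (fun j w => a *: var_ysub u w)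
         (fun w => a *: var_z u w).

Lemma lp_addA : associative lp_add.
Proof. by move=> u v w; apply: lp_vars_ext => *; rewrite /= addrA. Qed.
Lemma lp_addC : commutative lp_add.
Proof. by move=> u v; apply: lp_vars_ext => *; rewrite /= addrC. Qed.
Lemma lp_add0 : left_id lp_zero lp_add.
Proof. by move=> u; apply: lp_vars_ext => *; rewrite /= add0r. Qed.
Lemma lp_addN : left_inverse lp_zero lp_opp lp_add.
Proof. by move=> u; apply: lp_vars_ext => *; rewrite /= addNr. Qed.

(** A module structure on the record itself lets the results on linear programs
    apply to it directly, with its dependent component left as it is. *)
HB.instance Definition _ := gen_eqMixin vars.
HB.instance Definition _ := gen_choiceMixin vars.
HB.instance Definition _ :=
  GRing.isZmodule.Build vars lp_addA lp_addC lp_add0 lp_addN.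

Lemma lp_scaleA a b u : lp_scale a (lp_scale b u) = lp_scale (a * b) u.
Proof. by apply: lp_vars_ext => *; rewrite /= scalerA. Qed.
Lemma lp_scale1 : left_id 1 lp_scale.
Proof. by move=> u; apply: lp_vars_ext => *; rewrite /= scale1r. Qed.
Lemma lp_scaleDr : right_distributive lp_scale +%R.
Proof. by move=> a u v; apply: lp_vars_ext => *; rewrite /= scalerDr. Qed.
Lemma lp_scaleDl u : {morph lp_scale^~ u : a b / a + b}.
Proof. by move=> a b; apply: lp_vars_ext => *; rewrite /= scalerDl. Qed.

HB.instance Definition _ := GRing.Zmodule_isLmodule.Build R vars
  lp_scaleA lp_scale1 lp_scaleDr lp_scaleDl.

Lemma dot_linear n (c u v : 'cV[R]_n) a :
  dot c (a *: u + v) = a * dot c u + dot c v.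
Proof.
rewrite /dot mulr_sumr -big_split; apply: eq_bigr => i _ /=.
by rewrite !mxE; ring.
Qed.

Lemma lp_objective_linear (q : lp_costs n_ law k) :
  linear_form (lp_objective q : vars -> R).
Proof.
move=> a u v; rewrite /lp_objective /= dot_linear.
under eq_bigr => j _ do
  (under eq_bigr => w _ do rewrite dot_linear mulrDr mulrCA;
   rewrite big_split -mulr_sumr).
rewrite big_split -mulr_sumr /=.
under [X in _ - X = _]eq_bigr => w _ do rewrite dot_linear mulrDr mulrCA.
rewrite big_split -mulr_sumr /=; ring.
Qed.

End VariableSpace.

(** * Scenario strings as a tree *)

Section Strings.
Context (R : realType) (K m M : nat).
Context (law : 'I_K -> 'cV['I_M.+1]_m -> R) (k : 'I_K).

(** The prefix that the node of height [e] consists of: the string of all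
    letters is the leaf, of height 0, and the empty string the root. *)
Definition string_key (e : nat) (w : Omega law k 0) : seq 'cV['I_M.+1]_m :=
  take (k.+1 - e) (letters w).

Lemma size_string_key e (w : Omega law k 0) : size (string_key e w) == (k.+1 - e)%N.
Proof. by rewrite size_takel // size_tuple leq_sub2l. Qed.

Lemma string_key_positive e (w : Omega law k 0) :
  [forall i : 'I_(k.+1 - e), 0 < law (level k i) (tnth (Tuple (size_string_key e w)) i)].
Proof.
apply/forallP => i.
have lt_i : (i < k.+1 - 0)%N by apply: leq_trans (ltn_ord i) _; rewrite leq_sub2l.
have := forallP (valP w) (Ordinal lt_i).
rewrite !(tnth_nth (const_mx ord0)) /= => pos.
by rewrite /string_key nth_take.
Qed.

Definition restrict e (w : Omega law k 0) : Omega law k e :=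
  exist _ (Tuple (size_string_key e w)) (string_key_positive e w).

Lemma letters_restrict e w : letters (restrict e w) = string_key e w.
Proof. by []. Qed.

Lemma restrictP e w (w' : Omega law k e) :
  prefix (letters w') (letters w) <-> w' = restrict e w.
Proof.
rewrite prefixE size_tuple; split=> [/eqP pre|->].
  by apply/val_inj/val_inj.
by rewrite letters_restrict.
Qed.

Lemma restrict_eq e w w' :
  string_key e w = string_key e w' -> restrict e w = restrict e w'.
Proof. by move=> ww'; apply/val_inj/val_inj. Qed.

Lemma string_key0_inj : injective (string_key 0).
Proof.
move=> w w'; rewrite /string_key !take_oversize ?size_tuple // => ww'.
exact/val_inj/val_inj.
Qed.

Lemma string_key_coarser e w w' :
  string_key e w = string_key e w' -> string_key e.+1 w = string_key e.+1 w'.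
Proof.
have le_e : (k.+1 - e.+1 <= k.+1 - e)%N by rewrite leq_sub2l.
rewrite /string_key => ww'.
by rewrite -(take_takel (letters w) le_e) ww' take_takel.
Qed.

Lemma string_key_root w w' : string_key k.+1 w = string_key k.+1 w'.
Proof. by rewrite /string_key subnn !take0. Qed.

End Strings.

(** * The linear program row by row *)

Section Rows.
Context (R : realType) (K m : nat) (n_ : 'I_K -> nat).
Context (A : 'M[nat]_(\sum_(k < K) n_ k, m)) (k : 'I_K).

(** The constraints seen by one scenario, in the order of the definition of
    feasibility.  Keeping apart the groups below [k], the group [k] and the groups
    above [k] avoids casts between [n_ (below j)] and [n_ j]. *)
Definition lp_row : finType :=
  ('I_m + ({j : 'I_k & 'I_(n_ (below j))} + ('I_(n_ k) +
     {j : {j : 'I_K | (k < j)%N} & 'I_(n_ (val j))})))%type.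

Definition row_coef (r : lp_row) (l : 'I_m) : R :=
  match r with
  | inl i => (1%:M : 'M[R]_m) i l
  | inr (inl p) => nat_mx R (submxcol A (below (tag p))) (tagged p) l
  | inr (inr (inl i)) => nat_mx R (submxcol A k) i l
  | inr (inr (inr p)) => nat_mx R (submxcol A (val (tag p))) (tagged p) l
  end.

(** The right-hand side of a row of group [j <= k] is a variable of level [j];
    the inputs are placed above all variables. *)
Definition row_level (r : lp_row) : nat :=
  match r with
  | inl _ => k.+1
  | inr (inl p) => tag p
  | inr (inr (inl _)) => k
  | inr (inr (inr _)) => k.+1
  end.

Definition row_input (y : forall j : 'I_K, 'cV[R]_(n_ j)) (x : 'cV[R]_m)
    (r : lp_row) : R :=
  match r with
  | inl i => x i 0
  | inr (inr (inr p)) => y (val (tag p)) (tagged p) 0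
  | _ => 0
  end.

Context (M : nat) (law : 'I_K -> 'cV['I_M.+1]_m -> R).

Definition row_demand (w : Omega law k 0) (r : lp_row) : R :=
  if r is inl i then total_demand w i 0 else 0.

Definition row_var (u : lp_vars n_ law k) (w : Omega law k 0) (r : lp_row) : R :=
  match r with
  | inr (inl p) => var_ysub u (restrict (tag p).+1 w) (tagged p) 0
  | inr (inr (inl i)) => var_y u i 0
  | _ => 0
  end.

(** The part of a constraint that depends on the variables; inputs and demands
    are left on the right-hand side. *)
Definition constraint (c : Omega law k 0 * lp_row) (u : lp_vars n_ law k) : R :=
  \sum_l row_coef c.2 l * var_z u c.1 l 0 - row_var u c.1 c.2.

Lemma row_var_linear w r : linear_form (fun u => row_var u w r).
Proof. by move=> a u v; case: r => [i|[p|[i|p]]] /=; rewrite ?mxE //; ring. Qed.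

Lemma constraint_linear c : linear_form (constraint c).
Proof.
move=> a u v; rewrite /constraint row_var_linear.
under eq_bigr => l _ do rewrite /= !mxE mulrDr mulrCA.
rewrite big_split -mulr_sumr /=; ring.
Qed.

Lemma lp_feasibleE y x u : lp_feasible A y x u <->
  forall c, constraint c u <= row_input y x c.2 + row_demand c.1 c.2.
Proof.
split=> [[Fz Fsub Ftop Fin] [w r]|F].
  rewrite /constraint; case: r => [i|[[j i]|[i|[j i]]]] /=.
  - have := Fz w i; rewrite -{1}[var_z u w]mul1mx !mxE; lra.
  - have := Fsub j w (restrict j.+1 w) (proj2 (restrictP _ _) erefl) i.
    rewrite !mxE; lra.
  - by have := Ftop w i; rewrite !mxE; lra.
  - by have := Fin w (val j) (valP j) i; rewrite !mxE; lra.
rewrite /constraint in F; split.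
- move=> w i; rewrite -[var_z u w]mul1mx.
  by have := F (w, inl i); rewrite /= !mxE; lra.
- move=> j w _ /restrictP -> i.
  have := F (w, inr (inl (Tagged (fun j => 'I_(n_ (below j))) i))).
  rewrite /= !mxE; lra.
- by move=> w i; have := F (w, inr (inr (inl i))); rewrite /= !mxE; lra.
- move=> w j lt_kj i.
  have := F (w, inr (inr (inr
    (@existT _ (fun j : {j : 'I_K | (k < j)%N} => 'I_(n_ (val j)))
       (exist _ j lt_kj) i)))).
  rewrite /= !mxE; lra.
Qed.

End Rows.

(** * Lipschitz continuity of the optimal y^k *)

Section Main.
Context (R : realType) (K m : nat) (n_ : 'I_K -> nat).
Context (A : 'M[nat]_(\sum_(k < K) n_ k, m)) (k : 'I_K) (M : nat).
Context (law : 'I_K -> 'cV['I_M.+1]_m -> R).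

Lemma row_var_adapted (u : lp_vars n_ law k) y x :
  adapted (@row_level K m n_ k) (@string_key R K m M law k)
    (fun w r => row_var u w r + row_input y x r).
Proof.
move=> [i|[p|[i|p]]] w w' //= ww'; congr (_ + _).
by rewrite (restrict_eq ww').
Qed.

Lemma row_var_top (u : lp_vars n_ law k) w (r : lp_row m n_ k) :
  (k < row_level r)%N -> row_var u w r = 0.
Proof. by case: r => [i|[[j i]|[i|p]]] //=; rewrite ltnNge ?leqnn // ltnW. Qed.

(** Any scenario below a node can provide the variables of that node, because
    [zeta] is adapted.  The default 0 goes to variables that occur in no
    constraint: those of strings that are not a prefix of any scenario, and
    [var_y] itself when there is no scenario at all. *)
Lemma assemble (z : Omega law k 0 -> 'I_m -> R)
    (zeta : Omega law k 0 -> lp_row m n_ k -> R) y x :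
  adapted (@row_level K m n_ k) (@string_key R K m M law k) zeta ->
  (forall w r, (k < row_level r)%N -> zeta w r = row_input y x r) ->
  exists u : lp_vars n_ law k,
  [/\ forall w l, var_z u w l 0 = z w l,
      forall w r, row_var u w r + row_input y x r = zeta w r &
      forall i, var_y u i 0 = 0 \/ exists w, var_y u i 0 = zeta w (inr (inr (inl i)))].
Proof.
move=> zeta_adapted zeta_top.
pose sub_row (j : 'I_k) (i : 'I_(n_ (below j))) : lp_row m n_ k :=
  inr (inl (existT _ j i)).
exists (LpVars
  (\col_i
     (if [pick w : Omega law k 0] is Some w then zeta w (inr (inr (inl i)))
      else 0 : R))
  (fun j w' => \col_i
     if [pick w : Omega law k 0 | restrict j.+1 w == w'] is Some w
     then zeta w (sub_row j i) else 0)
  (fun w => \col_l z w l)).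
split=> [w l|w r|i] /=; rewrite ?mxE //.
- case: r => [i|[[j i]|[i|p]]] /=; rewrite ?mxE ?add0r ?addr0.
  + by rewrite (zeta_top w).
  + case: pickP => [w1 /eqP ww1|/(_ w)]; last by rewrite eqxx.
    apply: zeta_adapted => /=.
    by have := congr1 (@letters _ _ _ _ _ _ _) ww1; rewrite !letters_restrict.
  + case: pickP => [w1 _|/(_ w) //].
    by apply: zeta_adapted; apply: string_key_root.
  + by rewrite (zeta_top w).
- by case: pickP => [w _|_]; [right; exists w|left].
Qed.

Lemma entry_le_norm n (v : 'cV[R]_n) i : `|v i 0| <= `|v|.
Proof.
rewrite -[leRHS]/(mx_norm v) mx_normrE.
exact: (le_bigmax _ (fun ij : 'I_n * 'I_1 => `|v ij.1 ij.2|) (i, 0)).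
Qed.

Lemma norm_le_entries n (v : 'cV[R]_n) c :
  0 <= c -> (forall i, `|v i 0| <= c) -> `|v| <= c.
Proof.
move=> c_ge0 v_le; rewrite -[leLHS]/(mx_norm v) mx_normrE.
by apply: bigmax_le => // -[i j] _; rewrite ord1.
Qed.

(** [optimum_follows] applies to the data that interpolate linearly between the
    inputs [a] and [b], with the bound on the tree as speed limit; the solution
    that it produces is [u_b] by uniqueness. *)
Theorem lp_solution_lipschitz (kappa : R) (kappa_ge0 : 0 <= kappa) :
  tree_bounded (@row_coef R K m n_ A k) (@row_level K m n_ k) k kappa ->
  forall (q : lp_costs n_ law k) (y_a y_b : forall j : 'I_K, 'cV[R]_(n_ j))
    (x_a x_b : 'cV[R]_m) (u_a u_b : lp_vars n_ law k),
  lp_optimal A q y_a x_a u_a -> lp_unique_optimal A q y_b x_b u_b ->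
  `|var_y u_a - var_y u_b| <=
    kappa * (\sum_(j < K | (k < j)%N) `|y_a j - y_b j| + `|x_a - x_b|).
Proof.
move=> bound q y_a y_b x_a x_b u_a u_b [u_aF u_amin] [[u_bF u_bmin] u_b_unique].
set rho : R := (X in kappa * X).
have sum_ge0 : 0 <= \sum_(j < K | (k < j)%N) `|y_a j - y_b j| by apply: sumr_ge0.
have rho_ge0 : 0 <= rho by rewrite addr_ge0.
pose dy j := y_b j - y_a j.
pose dx := x_b - x_a.
have input_le (r : lp_row m n_ k) : `|row_input dy dx r| <= rho.
  case: r => [i|[p|[i|p]]] /=; rewrite ?normr0 //.
    by apply: le_trans (entry_le_norm _ _) _; rewrite distrC lerDr.
  apply: le_trans (entry_le_norm _ _) _; rewrite distrC.
  rewrite /rho (bigD1 (val (tag p))) ?(valP (tag p)) //= -addrA lerDl.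
  by rewrite addr_ge0 // sumr_ge0.
pose r (c : Omega law k 0 * lp_row m n_ k) := row_input y_a x_a c.2 + row_demand c.1 c.2.
pose d (c : Omega law k 0 * lp_row m n_ k) := row_input dy dx c.2.
have feas0 u :
    feasible_at (@constraint R K m n_ A k M law) r d 0 u <-> lp_feasible A y_a x_a u.
  rewrite lp_feasibleE; split=> F c; have := F c; rewrite ?mul0r ?addr0 ?inE //.
  by apply.
have feas1 u :
    feasible_at (@constraint R K m n_ A k M law) r d 1 u <-> lp_feasible A y_b x_b u.
  have rd c : r c + 1 * d c = row_input y_b x_b c.2 + row_demand c.1 c.2.
    rewrite mul1r /r /d addrAC; congr (_ + _).
    by case: c.2 => [i|[p|[i|p]]] /=; rewrite ?addr0 // !mxE; ring.
  rewrite lp_feasibleE; split=> F c; have := F c; rewrite -rd ?inE //.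
  by apply.
pose eta (i : 'I_(n_ k)) (u : lp_vars n_ law k) := var_y u i 0.
have etaL i : linear_form (eta i) by move=> a u v; rewrite /eta /= !mxE.
have [||||u [uF umin u_near]] := @optimum_follows R _ _ _ (@constraint R K m n_ A k M law)
    (@constraint_linear _ _ _ _ A k _ law) _ (lp_objective_linear q) eta etaL r d
    (kappa * rho) _ u_a u_b.
- move=> I e eI.
  have [||z' [zeta' [zeta'_adapted z'I zeta'_top zeta'_le]]] :=
    bound _ _ _ (@string_key0_inj _ _ _ _ law k) (@string_key_coarser _ _ _ _ law k)
      (@string_key_root _ _ _ _ law k) I (fun w l => var_z e w l 0) _ rho
      (row_var_adapted e dy dx) _ rho_ge0.
  + by move=> w s /eI; rewrite /constraint /d /= => <-; ring.
  + by move=> w s lt_ks; rewrite row_var_top // add0r.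
  have [|e' [e'z e'zeta e'y]] := @assemble z' zeta' dy dx zeta'_adapted _.
    by move=> w s lt_ks; rewrite zeta'_top // row_var_top // add0r.
  exists e' => [[w s] cI|i].
    rewrite /constraint /d /=; under eq_bigr => l _ do rewrite e'z.
    by rewrite (z'I w s cI) -e'zeta; ring.
  rewrite /eta; case: (e'y i) => [->|[w ->]]; last exact: zeta'_le.
  by rewrite normr0 mulr_ge0.
- by apply/feas0.
- by move=> v /feas0; apply: u_amin.
- by apply/feas1.
have <- : u = u_b.
  by apply: u_b_unique; split; [apply/feas1|move=> v /feas1; apply: umin].
apply: norm_le_entries => [|i]; first by rewrite mulr_ge0.
by have := u_near i; rewrite /eta /= !mxE distrC.
Qed.

End Main.

Theorem theorem6 (R : realType) (K m : nat) (n_ : 'I_K -> nat)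
    (A : 'M[nat]_(\sum_(k < K) n_ k, m))
    (A_row : forall i, exists j, A i j != 0%N)
    (A_col : forall j, exists i, A i j != 0%N) :
  exists kappa : R,
  forall (h : 'cV[R]_(\sum_(k < K) n_ k)) (b : 'cV[R]_m)
    (h_pos : pos_cv h) (b_pos : pos_cv b)
    (d : measure_display) (T : measurableType d) (P : probability T R)
    (D : 'I_K -> T -> 'cV[nat]_m)
    (D_meas : forall k, random_vector (D k))
    (D_indep : independent P D)
    (L : nat -> R) (L_0 : L 0%N = 0)
    (L_incr : forall k, (k < K)%N -> L k < L k.+1)
    (lambda : R) (mu : 'cV[nat]_m -> R)
    (lambda_pos : 0 < lambda) (mu_law : batch_law mu)
    (D_cpoisson : forall k : 'I_K,
       compound_poisson P (lambda * (L k.+1 - L k)) mu (D k))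
    (M : nat) (M_pos : (0 < M)%N) (k : 'I_K),
  exists2 eps : R, 0 < eps &
  forall (q : lp_costs n_ (trunc_law P D (M := M)) k)
    (q_near : costs_within eps q
                (nominal_costs A (trunc_law P D (M := M)) k h b))
    (y_a y_b : forall j : 'I_K, 'cV[R]_(n_ j)) (x_a x_b : 'cV[R]_m)
    (u_a u_b : lp_vars n_ (trunc_law P D (M := M)) k)
    (u_a_opt : lp_unique_optimal A q y_a x_a u_a)
    (u_b_opt : lp_unique_optimal A q y_b x_b u_b),
  `|var_y u_a - var_y u_b| <=
    kappa * (\sum_(j < K | (k < j)%N) `|y_a j - y_b j| + `|x_a - x_b|).
Proof.
have [kap kap_ge0 kapP] := fin_all_exists2 (fun k : 'I_K =>
  tree_bound (@row_coef R K m n_ A k) (@row_level K m n_ k) k).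
exists (\sum_k kap k) => h b _ _ d T P D _ _ L _ _ lambda mu _ _ _ M _ k.
exists 1 => // q _ y_a y_b x_a x_b u_a u_b [u_a_opt _] u_b_opt.
apply: le_trans (lp_solution_lipschitz (kap_ge0 k) (kapP k) u_a_opt u_b_opt) _.
apply: ler_wpM2r; first by rewrite addr_ge0 // sumr_ge0.
by rewrite (bigD1 k) //= lerDl sumr_ge0.
Qed.
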